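(* Let $f\in\mathrm{dom}(\mathcal{E})$ and let $G_f=\{(\mathbf{x},f(\mathbf{x})):\mathbf{x}\in\mathcal{S}\}\subset\mathbb{R}^3$ be its graph. Then the box dimension of $G_f$ has lower bound $\frac{\log3}{\log2}$ and upper bound $\frac{\log(108/5)}{2\log2}\approx2.21648$, that is, $$\frac{\log3}{\log2}\le\underline{\dim}_B(G_f)\le\overline{\dim}_B(G_f)\le\frac{\log(108/5)}{2\log2}.$$
   Context: Let $\mathcal{S}_0=\{q_1,q_2,q_3\}\subset\mathbb{R}^2$ be three points equidistant from each other, $L_i(x)=\frac12(x-q_i)+q_i$ for $i=1,2,3$, and let $\mathcal{S}\subset\mathbb{R}^2$ be the Sierpiński gasket, i.e. the unique nonempty compact set with $\mathcal{S}=\bigcup_{i=1}^3L_i(\mathcal{S})$. $\Sigma^{(m)}$ is the set of words of length $m$ in the symbols $1,2,3$; for $\omega=w_1\cdots w_m$, $L_\omega=L_{w_1}\circ\cdots\circ L_{w_m}$ (identity for the empty word). Let $\mathcal{S}^{(m)}=\bigcup_{\omega\in\Sigma^{(m)}}L_\omega(\mathcal{S}_0)$; for $x,y\in\mathcal{S}^{(m)}$ write $x\sim_my$ if $x\ne y$ both belong to the same cell $L_\omega(\mathcal{S}_0)$ for some $\omega\in\Sigma^{(m)}$. For continuous $u:\mathcal{S}\to\mathbb{R}$ put $\mathcal{E}^{(m)}(u)=\left(\frac53\right)^m\sum_{x\sim_my}|u(x)-u(y)|^2$ (each unordered pair counted once). This is nondecreasing in $m$; $\mathcal{E}(u)=\lim_{m\to\infty}\mathcal{E}^{(m)}(u)\in[0,\infty]$,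 and $\mathrm{dom}(\mathcal{E})$ is the space of continuous $u:\mathcal{S}\to\mathbb{R}$ with $\mathcal{E}(u)<\infty$. For a nonempty bounded $F\subset\mathbb{R}^3$, let $N_\delta(F)$ be the least number of sets of diameter at most $\delta$ covering $F$; $\underline{\dim}_B(F)$ and $\overline{\dim}_B(F)$ are the $\liminf$ and $\limsup$ of $\frac{\log N_\delta(F)}{-\log\delta}$ as $\delta\to0^+$. *)

(* Defs.v *)
From HB Require Import structures.
From mathcomp Require Import all_boot all_order all_algebra.
From mathcomp Require Import all_classical all_reals all_analysis.
Import Order.TTheory GRing.Theory Num.Theory.
Import numFieldNormedType.Exports.

Set Implicit Arguments.
Unset Strict Implicit.
Unset Printing Implicit Defensive.

Local Open Scope classical_set_scope.
Local Open Scope ring_scope.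

(* The library norm on row vectors is the sup norm, hence a separate Euclidean
   distance. *)
Definition eucl_dist (R : realType) (n : nat) (x y : 'rV[R]_n) : R :=
  Num.sqrt (\sum_(i < n) (x 0 i - y 0 i) ^+ 2).

(* The diameter of the empty set is -oo. *)
Definition diam (R : realType) (n : nat) (U : set 'rV[R]_n) : \bar R :=
  ereal_sup [set (eucl_dist p.1 p.2)%:E | p in U `*` U].

Definition has_cover (R : realType) (n : nat) (F : set 'rV[R]_n) (d : R)
    (k : nat) : Prop :=
  exists U : 'I_k -> set 'rV[R]_n,
    (forall i, (diam (U i) <= d%:E)%E) /\ F `<=` \bigcup_i U i.

(* For bounded F and d > 0 the least k exists; otherwise the value may be the
   default 0. *)
Definition covering_number (R : realType) (n : nat) (F : set 'rV[R]_n)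
    (d : R) : nat :=
  xget 0%N [set k | has_cover F d k /\
                    forall j, has_cover F d j -> (k <= j)%N].

Definition box_quotient (R : realType) (n : nat) (F : set 'rV[R]_n)
    (d : R) : R :=
  ln (covering_number F d)%:R / - ln d.

Definition lower_box_dim (R : realType) (n : nat) (F : set 'rV[R]_n) : \bar R :=
  limf_einf (fun d : R => (box_quotient F d)%:E) 0^'+.

Definition upper_box_dim (R : realType) (n : nat) (F : set 'rV[R]_n) : \bar R :=
  limf_esup (fun d : R => (box_quotient F d)%:E) 0^'+.

Definition equidistant (R : realType) (q : 'I_3 -> 'rV[R]_2) : Prop :=
  exists2 d : R, 0 < d & forall i j, i != j -> eucl_dist (q i) (q j) = d.

Definition contraction (R : realType) (q : 'I_3 -> 'rV[R]_2) (i : 'I_3)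
    (x : 'rV[R]_2) : 'rV[R]_2 :=
  2^-1 *: (x - q i) + q i.

Definition is_gasket (R : realType) (q : 'I_3 -> 'rV[R]_2)
    (S : set 'rV[R]_2) : Prop :=
  [/\ S !=set0, compact S & S = \bigcup_i (contraction q i @` S)].

Definition word_map (R : realType) (q : 'I_3 -> 'rV[R]_2) (w : seq 'I_3)
    (x : 'rV[R]_2) : 'rV[R]_2 :=
  foldr (contraction q) x w.

Definition cell (R : realType) (q : 'I_3 -> 'rV[R]_2) (w : seq 'I_3) :
    set 'rV[R]_2 :=
  word_map q w @` range q.

Definition vertices (R : realType) (q : 'I_3 -> 'rV[R]_2) (m : nat) :
    set 'rV[R]_2 :=
  \bigcup_(w : m.-tuple 'I_3) cell q w.

Definition cell_adjacent (R : realType) (q : 'I_3 -> 'rV[R]_2) (m : nat)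
    (x y : 'rV[R]_2) : Prop :=
  x <> y /\ exists w : m.-tuple 'I_3, cell q w x /\ cell q w y.

(* The sum ranges over ordered pairs; the factor 1/2 makes each unordered pair
   count once. *)
Definition graph_energy (R : realType) (q : 'I_3 -> 'rV[R]_2) (m : nat)
    (u : 'rV[R]_2 -> R) : R :=
  (5 / 3) ^+ m *
  (2^-1 * \sum_(p \in [set p : 'rV[R]_2 * 'rV[R]_2 |
                        [/\ vertices q m p.1, vertices q m p.2 &
                            cell_adjacent q m p.1 p.2]])
            `|u p.1 - u p.2| ^+ 2).

Definition energy (R : realType) (q : 'I_3 -> 'rV[R]_2)
    (u : 'rV[R]_2 -> R) : \bar R :=
  limn (fun m => (graph_energy q m u)%:E).

(* A function on S is represented by a total function on the plane; only its
   values on S are constrained or used. *)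
Definition dom_energy (R : realType) (q : 'I_3 -> 'rV[R]_2)
    (S : set 'rV[R]_2) : set ('rV[R]_2 -> R) :=
  [set u | {within S, continuous u} /\ (energy q u < +oo)%E].

Definition graph_on (R : realType) (S : set 'rV[R]_2) (f : 'rV[R]_2 -> R) :
    set 'rV[R]_3 :=
  [set (row_mx x (const_mx (f x)) : 'rV[R]_(2 + 1)) | x in S].

(* Main.v *)
(* Write L_w for the map of a word w of length m. In barycentric coordinates the
   points L_w(q_0) are distinct dyadic points of step 2^-m, hence separated by
   2^-m / K; a set of small diameter thus contains at most one of the 3^m graph
   points above them, which gives the lower bound. For the upper bound, each
   energy E^(m)(f) is at most E(f) by monotonicity, so f varies by
   O((3/5)^(m/2)) along the edges of a level-m cell; telescoping through the
   corners of nested cells extends this to all of L_w(S). The graph above L_w(S)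
   is then covered by O(2^m (3/5)^(m/2)) sets of diameter O(2^-m), and
   3 * 2 * (3/5)^(1/2) = (108/5)^(1/2). *)
Require Import Defs.
From HB Require Import structures.
From mathcomp Require Import all_boot all_order all_algebra.
From mathcomp Require Import all_classical all_reals all_analysis.
From mathcomp Require Import ring lra.
Import Order.TTheory GRing.Theory Num.Theory.
Import numFieldNormedType.Exports.

Local Open Scope classical_set_scope.
Local Open Scope ring_scope.

(** * Euclidean distance against coordinates *)

Section EuclDist.
Context {R : realType} {n : nat}.
Implicit Types x y : 'rV[R]_n.

Lemma eucl_dist_sqr x y :
  eucl_dist x y ^+ 2 = \sum_(i < n) (x 0 i - y 0 i) ^+ 2.
Proof. by rewrite sqr_sqrtr// sumr_ge0// => i _; rewrite sqr_ge0. Qed.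

Lemma eucl_dist_ge0 x y : 0 <= eucl_dist x y.
Proof. exact: sqrtr_ge0. Qed.

Lemma coord_le_eucl_dist x y i : `|x 0 i - y 0 i| <= eucl_dist x y.
Proof.
rewrite -sqrtr_sqr ler_sqrt ?sumr_ge0// => [|j _]; last by rewrite sqr_ge0.
by rewrite (bigD1 i)//= lerDl sumr_ge0// => j _; rewrite sqr_ge0.
Qed.

Lemma eucl_dist_le x y (c : R) :
  (forall i, `|x 0 i - y 0 i| <= c) -> 0 <= c -> eucl_dist x y <= n%:R * c.
Proof.
move=> xyc c0; rewrite -(@ler_pXn2r _ 2)// ?nnegrE ?eucl_dist_ge0 ?mulr_ge0//.
rewrite eucl_dist_sqr exprMn.
apply: (@le_trans _ _ (\sum_(i < n) c ^+ 2)).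
  apply: ler_sum => i _; rewrite -real_normK ?num_real//.
  by rewrite ler_pXn2r// nnegrE.
rewrite sumr_const card_ord -[leLHS]mulr_natl ler_wpM2r ?sqr_ge0//.
(* The crude bound n <= n^2 suffices, so [n] stands in place of its square root. *)
by rewrite -natrX ler_nat; case: n => // k; rewrite -[leqLHS]expn1 leq_pexp2l.
Qed.

End EuclDist.

Lemma sum_I2 (V : nmodType) (F : 'I_2 -> V) : \sum_(i < 2) F i = F 0 + F 1.
Proof.
by rewrite !big_ord_recl big_ord0 addr0; congr (_ + F _); exact: val_inj.
Qed.

Lemma ord3E (k : 'I_3) : [\/ k = 0, k = 1 | k = 2].
Proof.
case: k => -[|[|[|//]]] ?; [apply: Or31|apply: Or32|apply: Or33];
exact: val_inj.
Qed.

(** * Barycentric coordinates of the triangle *)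

Section Barycentric.
Context {R : realType} (q : 'I_3 -> 'rV[R]_2).

Let ctr (k : 'I_2) : R := (q 0 0 k + q 1 0 k + q 2 0 k) / 3.

(* The barycentric coordinate at [q s] of the equilateral triangle: its
   gradient points from the centroid towards [q s]. *)
Definition bary (s : 'I_3) (x : 'rV[R]_2) : R :=
  3^-1 + 2 / eucl_dist (q 0) (q 1) ^+ 2 *
    \sum_(k < 2) (x 0 k - ctr k) * (q s 0 k - ctr k).

(** [bary s] is affine, so at the midpoint of [x] and [q i] it averages its two values; the value at
    [q i] is 1 or 0 because the triangle is equilateral. *)
Lemma bary_contraction (hq : equidistant q) s i x :
  bary s (Defs.contraction q i x) = (bary s x + (i == s)%:R) / 2.
Proof.
have [d d0 hd] := hq.
have hd2 j k : j != k ->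
    (q j 0 0 - q k 0 0) ^+ 2 + (q j 0 1 - q k 0 1) ^+ 2 = d ^+ 2.
  by move=> /hd <-; rewrite eucl_dist_sqr sum_I2.
have := hd2 0 1 isT; have := hd2 0 2 isT; have := hd2 1 2 isT.
move=> h12 h02 h01.
have dn0 : d != 0 by rewrite gt_eqF.
have bq : bary s (q i) = (i == s)%:R.
  rewrite /bary hd// /ctr sum_I2.
  (* Clearing the denominator makes the claim linear in the three squared side lengths. *)
  apply: (@mulfI _ (d ^+ 2)); first by rewrite expf_neq0.
  rewrite mulrDr [X in _ + X]mulrA [_ * (2 / _)]mulrC divfK ?expf_neq0//.
  have [->|->|->] := ord3E s; have [->|->|->] := ord3E i; 
    rewrite ?eqxx /= ?mulr1 ?mulr0; lra.
rewrite -bq /bary /Defs.contraction !sum_I2 !mxE.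
set c := 2 / _; by field.
Qed.

Lemma bary_lipschitz : exists2 K : R, 0 < K &
  forall s x y, `|bary s x - bary s y| <= K * eucl_dist x y.
Proof.
rewrite /bary; set c := 2 / eucl_dist (q 0) (q 1) ^+ 2.
have c0 : 0 <= c by rewrite divr_ge0// sqr_ge0.
clearbody c; pose T s := \sum_(k < 2) `|q s 0 k - ctr k|.
have T0 s : 0 <= T s by exact: sumr_ge0.
(* The sum over [s] serves all three coordinates at once; the [+ 1] secures positivity. *)
exists (c * (\sum_s T s) + 1).
  by rewrite ltr_wpDl// mulr_ge0// sumr_ge0.
move=> s x y; rewrite opprD addrACA subrr add0r -mulrBr -sumrB.
rewrite normrM (ger0_norm c0) mulrDl mul1r -[leLHS]addr0 lerD ?eucl_dist_ge0//.
rewrite -mulrA ler_wpM2l// (bigD1 s)//= mulrDl -[leLHS]addr0 lerD//; last first.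
  by rewrite mulr_ge0 ?eucl_dist_ge0// sumr_ge0.
rewrite /T mulr_suml (le_trans (ler_norm_sum _ _ _))// ler_sum// => k _.
rewrite -mulrBl opprB addrA addrNK mulrC normrM ler_wpM2l//.
exact: coord_le_eucl_dist.
Qed.

End Barycentric.

(** * Word maps and the separation of cells *)

Section WordMap.
Context {R : realType} (q : 'I_3 -> 'rV[R]_2).
Local Notation L := (word_map q).

Lemma word_map_cat w1 w2 x : L (w1 ++ w2) x = L w1 (L w2 x).
Proof. exact: foldr_cat. Qed.

Lemma word_mapB w x y : L w x - L w y = 2^-1 ^+ size w *: (x - y).
Proof.
elim: w => [|s w IH] /=; first by rewrite scale1r.
rewrite /Defs.contraction opprD addrACA subrr addr0 -scalerBr opprB addrA.
by rewrite addrNK IH scalerA -exprS.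
Qed.

Lemma contraction_corner i : Defs.contraction q i (q i) = q i.
Proof. by rewrite /Defs.contraction subrr scaler0 add0r. Qed.

Lemma contraction_swap i j :
  Defs.contraction q i (q j) = Defs.contraction q j (q i).
Proof. by apply/rowP => k; rewrite !mxE; field. Qed.

Lemma word_map_rcons_corner w i : L (rcons w i) (q i) = L w (q i).
Proof. by rewrite -cats1 word_map_cat /= contraction_corner. Qed.

(** Each letter adds 0 or 1 before halving, so the offset accumulated along [w] lies between 0 and
    the sum of the 2^-k for k from 1 to [size w]. *)
Lemma bary_word_map_bounds (hq : equidistant q) s w x :
  2^-1 ^+ size w * bary q s x <= bary q s (L w x)
    <= 1 - 2^-1 ^+ size w + 2^-1 ^+ size w * bary q s x.
Proof.
elim: w => [|i w /andP[IH1 IH2]] /=; first by rewrite mul1r subrr add0r lexx.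
rewrite bary_contraction// exprS; set a := _ ^+ _ in IH1 IH2 *.
have : 0 <= (i == s)%:R :> R by [].
have : (i == s)%:R <= 1 :> R by case: eqP.
by move=> h1 h0; apply/andP; split; lra.
Qed.

(* Where the words first differ, [bary] gains [1 / 2] on one side only, and the
   tails cannot compensate this by the bounds above. *)
Lemma bary_word_map_sep (hq : equidistant q) w w' x :
  size w = size w' -> w != w' ->
  exists s, 2^-1 ^+ size w <= `|bary q s (L w x) - bary q s (L w' x)|.
Proof.
elim: w w' => [|i w IH] [|j w']//= [ww'] neq.
have [ij|ij] := eqVneq i j.
  have [|s hs] := IH w' ww'; first by move: neq; rewrite ij eqseq_cons eqxx.
  exists s; rewrite !bary_contraction// ij -mulrBl opprD addrACA subrr addr0.
  by rewrite normrM [X in _ * X]ger0_norm// exprS mulrC ler_wpM2r.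
exists i; rewrite !bary_contraction// eqxx eq_sym (negbTE ij) addr0.
have /andP[h1 _] := bary_word_map_bounds hq i w x.
have /andP[_ h2] := bary_word_map_bounds hq i w' x.
rewrite (le_trans _ (ler_norm _))// exprS; rewrite -ww' in h2.
by set a := _ ^+ _ in h1 h2 *; rewrite /=; lra.
Qed.

(** This lets the energy sum be indexed by words and oriented edges without repetition. Along an
    edge, the differences of barycentric coordinates reveal both labels; equal images of one corner
    then force equal words by separation. *)
Lemma word_map_edge_inj (hq : equidistant q) w w' i j i' j' :
  size w = size w' -> i != j ->
  L w (q i) = L w' (q i') -> L w (q j) = L w' (q j') ->
  [/\ w = w', i = i' & j = j'].
Proof.
move=> ww' ij ei ej.
(* As [q k] is fixed by its contraction, its coordinate b solves b = (b + (k == s)) / 2. *)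
have lamq s k : bary q s (q k) = (k == s)%:R.
  have := bary_contraction q hq s k (q k); rewrite contraction_corner; lra.
have lamB s v x y : bary q s (L v x) - bary q s (L v y) =
    2^-1 ^+ size v * (bary q s x - bary q s y).
  elim: v => [|k v IH] /=; first by rewrite mul1r.
  rewrite !bary_contraction// -mulrBl opprD addrACA subrr addr0 IH exprS.
  by ring.
have hs s : (i == s)%:R - (j == s)%:R = (i' == s)%:R - (j' == s)%:R :> R.
  apply: (@mulfI _ (2^-1 ^+ size w)); first by rewrite expf_neq0.
  by rewrite -!lamq -lamB ei ej lamB ww'.
have ii : i = i'.
  have := hs i; rewrite eqxx (eq_sym j) (negbTE ij).
  by have [//|_] := eqVneq i' i; case: eqP => _ /= h; exfalso; clear -h; lra.
have jj : j = j'.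
  have := hs j; rewrite eqxx (negbTE ij).
  by have [//|_] := eqVneq j' j; case: eqP => _ /= h; exfalso; clear -h; lra.
split=> //; apply/eqP/negPn/negP => /(bary_word_map_sep hq _ _ (q i) ww')[s].
by rewrite ei -ii subrr normr0 leNgt exprn_gt0.
Qed.

End WordMap.

(** * Sums over words and monotonicity of the graph energies *)

Lemma big_tuple_cons (V : nmodType) (T : finType) m (F : m.+1.-tuple T -> V) :
  \sum_(w : m.+1.-tuple T) F w =
  \sum_(s : T) \sum_(w : m.-tuple T) F [tuple of s :: w].
Proof.
rewrite pair_big /=.
rewrite (reindex (fun p : T * m.-tuple T => [tuple of p.1 :: p.2]))//=.
exists (fun t => (thead t, [tuple of behead t])) => [[s w] _|w _] /=.
  by rewrite theadE; congr pair; exact: val_inj.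
by rewrite -tuple_eta.
Qed.

Lemma big_tuple0 (V : nmodType) (T : finType) (F : 0.-tuple T -> V) :
  \sum_(w : 0.-tuple T) F w = F [tuple].
Proof. by rewrite (big_pred1 [tuple])// => w; rewrite [w]tuple0 /= eqxx. Qed.

Lemma sum_I3 (V : nmodType) (F : 'I_3 -> V) :
  \sum_(i < 3) F i = F 0 + F 1 + F 2.
Proof.
rewrite !big_ord_recl big_ord0 addr0 addrA.
by congr (_ + F _ + F _); exact: val_inj.
Qed.

Section Energy.
Context {R : realType} (q : 'I_3 -> 'rV[R]_2) (hq : equidistant q).
Local Notation L := (word_map q).
Implicit Type u : 'rV[R]_2 -> R.

Let cell_energy u : R :=
  \sum_(e : 'I_3 * 'I_3 | e.1 != e.2) `|u (q e.1) - u (q e.2)| ^+ 2.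

(** Every adjacent pair comes from exactly one word and one ordered pair of corners, which turns the
    sum over a set of points into a finite sum suited to induction on [m]. *)
Lemma graph_energyE m u : graph_energy q m u =
  (5 / 3) ^+ m * (2^-1 * \sum_(w : m.-tuple 'I_3) cell_energy (u \o L w)).
Proof.
rewrite /graph_energy; congr (_ * (_ * _)).
rewrite pair_big /=.
pose h (t : m.-tuple 'I_3 * ('I_3 * 'I_3)) :=
  (L t.1 (q t.2.1), L t.1 (q t.2.2)).
pose P (t : m.-tuple 'I_3 * ('I_3 * 'I_3)) := t.2.1 != t.2.2.
rewrite (@reindex_fsbig _ _ _ _ _ h [set` P]).
  rewrite -(@bigfs _ _ _ _ (index_enum _) P) ?index_enum_uniq// => t _.
  by rewrite mem_index_enum.
split=> [[w [i j]] /= ij|[w [i j]] [w' [i' j']]|[x y]] /=;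
  last move=> [vx vy [xy [w [[_ [i _ <-] xE] [_ [j _ <-] yE]]]]].
- split; [exists w|exists w|split; last exists w]=> //;
    try by exists (q i) => //; exists i.
  + by exists (q j) => //; exists j.
  + move=> ee; have : i = j; last by move=> /eqP; rewrite (negbTE ij).
    have [] := @word_map_edge_inj _ q hq w w i j j i erefl ij _ _ => //.
  + by split; [exists (q i) => //; exists i|exists (q j) => //; exists j].
- rewrite !inE /P /= => ij _ [ei ej].
  have ww' : size w = size w' by rewrite !size_tuple.
  have [ww -> ->] := @word_map_edge_inj _ q hq w w' i j i' j' ww' ij ei ej.
  by rewrite (val_inj ww).
- exists (w, (i, j)); last by rewrite /h /= xE yE.
  by rewrite /P /=; apply/eqP => /= ij; apply: xy; rewrite -xE -yE ij.
Qed.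

Let cell_energy_le u :
  cell_energy u <= 5 / 3 * \sum_s cell_energy (u \o Defs.contraction q s).
Proof.
have cE v : cell_energy v = 2 * ((v (q 0) - v (q 1)) ^+ 2 +
    (v (q 0) - v (q 2)) ^+ 2 + (v (q 1) - v (q 2)) ^+ 2).
  rewrite /cell_energy -(pair_big_dep xpredT (fun i j => i != j)
    (fun i j => `|v (q i) - v (q j)| ^+ 2)) /=.
  rewrite !sum_I3; under eq_bigr do rewrite real_normK ?num_real//.
  under [X in _ + X + _]eq_bigr do rewrite real_normK ?num_real//.
  under [X in _ + _ + X]eq_bigr do rewrite real_normK ?num_real//.
  by do 3 rewrite [\sum_(_ | _) _]big_mkcond sum_I3 /=; ring.
rewrite sum_I3 !cE /= !contraction_corner.
(* Subcells share the edge midpoints, so only six values of [u] occur. *)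
rewrite -!(contraction_swap q 0) -(contraction_swap q 1 2).
set a := u (q 0); set b := u (q 1); set c := u (q 2).
set x := u (Defs.contraction q 1 (q 2)).
set y := u (Defs.contraction q 0 (q 2)).
set z := u (Defs.contraction q 0 (q 1)).
(* Equality holds at the harmonic extension, which puts
   [(a + 2 b + 2 c) / 5] between [b] and [c]. *)
pose x' := x - (a + 2 * b + 2 * c) / 5.
pose y' := y - (b + 2 * a + 2 * c) / 5.
pose z' := z - (c + 2 * a + 2 * b) / 5.
rewrite -subr_ge0 [leRHS](_ : _ = 10 / 3 * ((x' - y') ^+ 2 + (y' - z') ^+ 2 +
   (z' - x') ^+ 2 + 2 * (x' ^+ 2 + y' ^+ 2 + z' ^+ 2))).
  by rewrite mulr_ge0// !addr_ge0 ?sqr_ge0// mulr_ge0// !addr_ge0 ?sqr_ge0.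
by rewrite /x' /y' /z'; field.
Qed.

(** Peeling off first letters, which replaces [u] by its composition with a contraction, reduces the
    claim to the subdivision of a single triangle. *)
Lemma graph_energy_nondecreasing u :
  {homo (fun m => graph_energy q m u) : m n / (m <= n)%N >-> m <= n}.
Proof.
apply/nondecreasing_seqP => m; rewrite !graph_energyE exprSr -mulrA.
rewrite ler_wpM2l ?exprn_ge0// mulrCA ler_wpM2l//.
elim: m u => [|m IH] u.
  rewrite big_tuple_cons big_tuple0 (le_trans (cell_energy_le _))//.
  by rewrite ler_wpM2l// ler_sum// => s _; rewrite big_tuple0.
rewrite big_tuple_cons [X in _ <= _ * X]big_tuple_cons mulr_sumr.
rewrite ler_sum// => s _.
exact: (IH (u \o Defs.contraction q s)).
Qed.

Lemma dom_energy_edge S u : dom_energy q S u ->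
  exists2 M : R, 0 <= M & forall (w : seq 'I_3) i j,
    `|u (L w (q i)) - u (L w (q j))| <= M * Num.sqrt (3 / 5) ^+ size w.
Proof.
move=> [_ Eoo].
pose E m := (graph_energy q m u)%:E.
have Emono : {homo E : m n / (m <= n)%N >-> (m <= n)%E}.
  by move=> m n mn; rewrite lee_fin graph_energy_nondecreasing.
have Ege0 m : 0 <= graph_energy q m u.
  rewrite graph_energyE !mulr_ge0 ?exprn_ge0// sumr_ge0// => w _.
  by rewrite sumr_ge0// => e _; exact: sqr_ge0.
have Ele m : (E m <= energy q u)%E.
  rewrite /energy (cvg_lim _ (ereal_nondecreasing_cvgn Emono))//.
  by apply: ereal_sup_ubound; exists m.
have Efin : energy q u \is a fin_num.
  by rewrite ge0_fin_numE// (le_trans _ (Ele 0%N))// lee_fin.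
(* Only one orientation of the edge is kept in the sum over ordered pairs, so the factor 1/2 of the
   energy becomes this 2. *)
exists (Num.sqrt (2 * fine (energy q u))) => [|w i j]; first exact: sqrtr_ge0.
have [->|ij] := eqVneq i j.
  by rewrite subrr normr0 mulr_ge0 ?sqrtr_ge0// exprn_ge0 ?sqrtr_ge0.
have := Ele (size w); rewrite -(fineK Efin) lee_fin graph_energyE => Ew.
rewrite -(@ler_pXn2r _ 2)// ?nnegrE ?mulr_ge0 ?exprn_ge0 ?sqrtr_ge0//.
rewrite exprMn exprAC !sqr_sqrtr//; last first.
  by rewrite mulr_ge0// -lee_fin fineK// (le_trans _ (Ele 0%N))// lee_fin.
have -> : (3 / 5) ^+ size w = ((5 / 3) ^+ size w)^-1 :> R.
  by rewrite -exprVn; congr (_ ^+ _); field.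
rewrite ler_pdivlMr ?exprn_gt0// mulrC.
have : `|u (L w (q i)) - u (L w (q j))| ^+ 2 <=
    \sum_(w0 : (size w).-tuple 'I_3) cell_energy (u \o L w0).
  rewrite (bigD1 (in_tuple w))//= /cell_energy (bigD1 (i, j))//= -addrA lerDl.
  rewrite addr_ge0// sumr_ge0// => v _.
  by rewrite sumr_ge0// => e _; exact: sqr_ge0.
move=> h; rewrite mulrCA ler_pdivrMl in Ew => //.
rewrite (le_trans _ Ew)// ler_wpM2l// exprn_ge0//.
Qed.

End Energy.

(** * Geometry of the gasket and oscillation on its cells *)

Lemma half_expr_small (R : realType) (D e : R) : 0 < e ->
  exists n, 2^-1 ^+ n * D < e.
Proof.
move=> e0; exists (Num.bound (D / e)).
rewrite exprVn ltr_pdivrMl ?exprn_gt0// mulrC -ltr_pdivrMl// mulrC.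
exact: upper_nthrootP.
Qed.

Section Gasket.
Context {R : realType} (q : 'I_3 -> 'rV[R]_2) (S : set 'rV[R]_2).
Context (hS : is_gasket q S).
Local Notation L := (word_map q).

Lemma gasket_word_map w x : S x -> S (L w x).
Proof.
move=> Sx; elim: w => //= i w IH; have [_ _ ->] := hS.
by exists i => //; exists (L w x).
Qed.

Lemma gasket_decomp n x : S x ->
  exists w : n.-tuple 'I_3, exists2 y, S y & x = L w y.
Proof.
elim: n x => [|n IH] x; first by exists [tuple], x.
have [_ _ SE] := hS; rewrite {1}SE => -[i _ [y /IH[w [z Sz ->]] <-]].
by exists [tuple of i :: w], z.
Qed.

Lemma gasket_diam : exists2 D : R, 0 < D &
  forall x y, S x -> S y -> eucl_dist x y <= D.
Proof.
have [_ /compact_bounded [M [_ hM]] _] := hS.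
(* Boundedness gives a norm bound by every real above [M]; this one is also positive. *)
have M0 : 0 < `|M| + 1 by rewrite ltr_wpDl.
have {}hM x i : S x -> `|x 0 i| <= `|M| + 1.
  move=> /hM/= h; apply: le_trans (h (`|M| + 1) _) => //; last first.
    by rewrite (le_lt_trans (ler_norm M))// ltrDl.
  rewrite [leRHS](_ : _ = mx_norm x)// mx_normrE.
  exact: (le_bigmax _ (fun ij => `|x ij.1 ij.2|) (0, i)).
exists (2 * (2 * (`|M| + 1))); first by rewrite !mulr_gt0.
move=> x y Sx Sy; apply: eucl_dist_le => [i|]; last by rewrite mulr_ge0// ltW.
by rewrite (le_trans (ler_normB _ _))// mulr_natl mulr2n lerD// hM.
Qed.

Lemma eucl_dist_word_map w x y :
  eucl_dist (L w x) (L w y) = 2^-1 ^+ size w * eucl_dist x y.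
Proof.
rewrite /eucl_dist -[X in X * _](@ger0_norm _ (2^-1 ^+ size w)) ?exprn_ge0//.
rewrite -sqrtr_sqr -sqrtrM ?sqr_ge0// mulr_sumr; congr Num.sqrt.
apply: eq_bigr => i _; rewrite -exprMn; congr (_ ^+ _).
by have /rowP/(_ i) := word_mapB q w x y; rewrite !mxE.
Qed.

Lemma eucl_ball_nbhs (x : 'rV[R]_2) (B : set 'rV[R]_2) : nbhs x B ->
  exists2 e : R, 0 < e & forall y, eucl_dist x y < e -> B y.
Proof.
move=> /nbhs_ballP[e /= e0 hB]; exists e => // y xy; apply: hB; split=> // i j.
by rewrite ord1; exact: le_lt_trans (coord_le_eucl_dist x y j) xy.
Qed.

(** [q i] is the fixed point of its contraction, hence the limit of the iterates of any point of
    [S], and [S] is closed. *)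
Lemma gasket_corner i : S (q i).
Proof.
have [[y Sy] cS _] := hS.
have clS : closed S by apply: compact_closed => //; exact: norm_hausdorff.
apply: clS => B /eucl_ball_nbhs[e e0 hB].
have [n hn] := half_expr_small _ (eucl_dist (q i) y) e e0.
exists (L (nseq n i) y); split; first exact: gasket_word_map.
apply: hB; have -> : q i = L (nseq n i) (q i).
  by elim: n {hn} => //= n <-; rewrite contraction_corner.
by rewrite eucl_dist_word_map size_nseq.
Qed.

Lemma gasket_oscillation (f : 'rV[R]_2 -> R) (M r : R) :
  {within S, continuous f} ->
  0 <= r < 1 -> 0 <= M ->
  (forall w i j, `|f (L w (q i)) - f (L w (q j))| <= M * r ^+ size w) ->
  forall w x j, S x ->
  `|f (L w x) - f (L w (q j))| <= M / (1 - r) * r ^+ size w.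
Proof.
move=> /subspace_continuousP cf /andP[r0 r1] M0 hM w x j Sx.
set B := M / (1 - r).
(* [B] is the sum of the geometric series of the M r^k; this identity closes the induction on
   words. *)
have MB : M + B * r = B by rewrite /B; field; rewrite subr_eq0 gt_eqF.
(* [L v (q s)] is a common corner of the cells of [v] and [rcons v s]. *)
have vertex v v' i k :
    `|f (L (v ++ v') (q i)) - f (L v (q k))| <= B * r ^+ size v.
  elim: v' v i k => [|s v' IH] v i k.
    rewrite cats0 (le_trans (hM _ _ _))// ler_wpM2r ?exprn_ge0//.
    by rewrite -MB lerDl mulr_ge0// divr_ge0// subr_ge0 ltW.
  rewrite -cat_rcons (le_trans (ler_distD (f (L v (q s))) _ _))//.
  rewrite -MB mulrDl addrC lerD// -(word_map_rcons_corner q v).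
  by rewrite (le_trans (IH _ _ _))// size_rcons exprS mulrA.
(* Continuity passes from corners to any point: a corner of a deep enough subcell containing [L w x]
   has a value of [f] within [e]. *)
apply/ler_addgt0Pr => e e0.
have /cvgrPdist_lt/(_ e e0) := cf _ (gasket_word_map w x Sx).
rewrite near_withinE => /eucl_ball_nbhs[d d0 hd].
have [D _ hD] := gasket_diam.
have [n hn] := half_expr_small _ D d d0.
have [v [y Sy xE]] := gasket_decomp n x Sx.
rewrite (le_trans (ler_distD (f (L (w ++ v) (q j))) _ _))// addrC lerD//.
rewrite ltW//; apply: hd; last exact/gasket_word_map/gasket_corner.
rewrite xE -word_map_cat eucl_dist_word_map (le_lt_trans _ hn)//.
rewrite ler_pM ?exprn_ge0 ?eucl_dist_ge0 ?hD//; last exact: gasket_corner.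
rewrite size_cat size_tuple exprD ler_piMl ?exprn_ge0// exprn_ile1//.
by rewrite invf_le1 ?ler1n.
Qed.

End Gasket.

(** * Covering numbers and box dimensions *)

Section Covering.
Context {R : realType} {n : nat}.
Implicit Types (F U : set 'rV[R]_n) (d : R).

Lemma diam_le U d : (forall x y, U x -> U y -> eucl_dist x y <= d) ->
  (diam U <= d%:E)%E.
Proof.
move=> Ud; apply: ge_ereal_sup => _ [[x y] [/= Ux Uy] <-].
by rewrite lee_fin Ud.
Qed.

Lemma eucl_dist_le_diam U d x y : (diam U <= d%:E)%E -> U x -> U y ->
  eucl_dist x y <= d.
Proof.
move=> Ud Ux Uy; rewrite -lee_fin (le_trans _ Ud)//.
by apply: ereal_sup_ubound; exists (x, y).
Qed.

Lemma has_cover_fin (I : finType) F d (U : I -> set 'rV[R]_n) :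
  (forall i, (diam (U i) <= d%:E)%E) -> F `<=` \bigcup_i U i ->
  has_cover F d #|I|.
Proof.
move=> Ud FU; exists (fun k => U (enum_val k)); split=> // x /FU[i _ Ui].
by exists (enum_rank i) => //; rewrite enum_rankK.
Qed.

(** One finite cover makes a least size exist, so the default value of [xget] does not occur. *)
Lemma covering_numberP F d k : has_cover F d k ->
  has_cover F d (covering_number F d) /\ (covering_number F d <= k)%N.
Proof.
move=> hk; have ex : exists k, `[< has_cover F d k >].
  by exists k; exact/asboolP.
case: (ex_minnP ex) => l /asboolP hl lmin.
have [] : [set k | has_cover F d k /\ forall j, has_cover F d j -> (k <= j)%N]
    (covering_number F d).
  by apply: (@xgetPex _ 0%N); exists l; split => // j hj; exact/lmin/asboolP.
by move=> h1 h2; split => //; exact: h2.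
Qed.

(** An additive constant vanishes after division by -ln d, so a bound up to [C] decides the
    dimension. *)
Lemma lower_box_dim_ge F (a C : R) :
  (\forall d \near 0^'+, a * - ln d - C <= ln (covering_number F d)%:R) ->
  (a%:E <= lower_box_dim F)%E.
Proof.
move=> hN; apply/lee_addgt0Pr => e e0.
rewrite -leeBlDr// -EFinB /lower_box_dim limf_einfE.
(* Below this threshold -ln d exceeds |C| / e, so [C] costs at most [e] in the quotient. *)
have small : \forall d \near (0 : R)^'+, 0 < d < expR (- (`|C| / e + 1)).
  near=> d; apply/andP; split; near: d; first exact: nbhs_right_gt.
  by apply: nbhs_right_lt; exact: expR_gt0.
set V := [set d | 0 < d < expR (- (`|C| / e + 1)) /\
  a * - ln d - C <= ln (covering_number F d)%:R].
suff h : ((a - e)%:E <= ereal_inf [set (box_quotient F d)%:E | d in V])%E.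
  apply: (le_trans h); apply: ereal_sup_ubound; exists V => //.
  exact: filterI.
apply: le_ereal_inf_tmp => _ [d [/andP[d0 dlt] hd] <-]; rewrite lee_fin.
have ln_d : `|C| / e + 1 < - ln d.
  by rewrite ltrNr -(expRK (- _)) ltr_ln// posrE expR_gt0.
have ln_d0 : 0 < - ln d.
  by rewrite (le_lt_trans _ ln_d)// addr_ge0// divr_ge0// ltW.
rewrite /box_quotient ler_pdivlMr// (le_trans _ hd)// mulrBl lerB//.
rewrite (le_trans (ler_norm C))// mulrC -ler_pdivrMr//.
rewrite (le_trans _ (ltW ln_d))//.
by rewrite lerDl.
Unshelve. all: by end_near. Qed.

Lemma upper_box_dim_le F (b C : R) :
  (\forall d \near 0^'+, ln (covering_number F d)%:R <= b * - ln d + C) ->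
  (upper_box_dim F <= b%:E)%E.
Proof.
move=> hN; apply/lee_addgt0Pr => e e0.
rewrite /upper_box_dim limf_esupE -EFinD.
have small : \forall d \near (0 : R)^'+, 0 < d < expR (- (`|C| / e + 1)).
  near=> d; apply/andP; split; near: d; first exact: nbhs_right_gt.
  by apply: nbhs_right_lt; exact: expR_gt0.
set V := [set d | 0 < d < expR (- (`|C| / e + 1)) /\
  ln (covering_number F d)%:R <= b * - ln d + C].
suff h : (ereal_sup [set (box_quotient F d)%:E | d in V] <= (b + e)%:E)%E.
  apply: (le_trans _ h); apply: ereal_inf_lbound; exists V => //.
  exact: filterI.
apply: ge_ereal_sup => _ [d [/andP[d0 dlt] hd] <-]; rewrite lee_fin.
have ln_d : `|C| / e + 1 < - ln d.
  by rewrite ltrNr -(expRK (- _)) ltr_ln// posrE expR_gt0.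
have ln_d0 : 0 < - ln d.
  by rewrite (le_lt_trans _ ln_d)// addr_ge0// divr_ge0// ltW.
rewrite /box_quotient ler_pdivrMr// (le_trans hd)// mulrDl lerD//.
rewrite (le_trans (ler_norm C))// mulrC -ler_pdivrMr//.
rewrite (le_trans _ (ltW ln_d))//.
by rewrite lerDl.
Unshelve. all: by end_near. Qed.

(** Any two right neighbourhoods of 0 meet, and the quotient at a common point lies between the
    infimum over one and the supremum over the other. *)
Lemma lower_box_dim_le_upper F : (lower_box_dim F <= upper_box_dim F)%E.
Proof.
rewrite /lower_box_dim /upper_box_dim limf_einfE limf_esupE.
apply: ge_ereal_sup => _ [V hV <-]; apply: le_ereal_inf_tmp => _ [W hW <-].
have [d [Vd Wd]] : V `&` W !=set0.
  by apply: (@filter_ex _ (0 : R)^'+); exact: filterI.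
apply: (@le_trans _ _ (box_quotient F d)%:E).
  by apply: ereal_inf_lbound; exists d.
by apply: ereal_sup_ubound; exists d.
Qed.

End Covering.

(** * Covers of the graph at dyadic scales *)

Lemma dyadic_scale (R : realType) (x : R) : 0 < x < 1 ->
  exists m, 2^-1 ^+ m.+1 <= x < 2^-1 ^+ m.
Proof.
move=> /andP[x0 x1]; have [n] := half_expr_small _ 1 x x0; rewrite mulr1 => hn.
have ex : exists n, 2^-1 ^+ n <= x by exists n; exact: ltW.
(* As [x < 1], the least exponent is not 0, and its predecessor gives the strict bound. *)
case: (ex_minnP ex) => -[|m] hm mmin; first by move: hm; rewrite leNgt x1.
exists m; rewrite hm ltNge; apply/negP => /mmin.
by rewrite ltnn.
Qed.

Section Graph.
Context {R : realType}.

(** The ascription reads width [2 + 1] as 3 by conversion, exactly as in [graph_on]. *)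
Definition lift3 (x : 'rV[R]_2) (s : R) : 'rV[R]_3 :=
  (row_mx x (const_mx s) : 'rV[R]_(2 + 1)).

Lemma eucl_dist_lift3 x y s t :
  eucl_dist (lift3 x s) (lift3 y t) ^+ 2 = eucl_dist x y ^+ 2 + (s - t) ^+ 2.
Proof.
rewrite !eucl_dist_sqr (@big_split_ord _ _ _ 2 1) /= big_ord1; congr (_ + _).
  apply: eq_bigr => i _; congr ((_ - _) ^+ 2); exact: (@row_mxEl _ _ 2 1).
have last z u : lift3 z u 0 (@rshift 2 1 ord0) = u.
  by rewrite [LHS](@row_mxEr _ _ 2 1) mxE.
by rewrite !last.
Qed.

Lemma eucl_dist_lift3_ge x y s t :
  eucl_dist x y <= eucl_dist (lift3 x s) (lift3 y t).
Proof.
rewrite -(@ler_pXn2r _ 2)// ?nnegrE ?eucl_dist_ge0// eucl_dist_lift3.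
by rewrite lerDl sqr_ge0.
Qed.

Lemma eucl_dist_lift3_le x y s t :
  eucl_dist (lift3 x s) (lift3 y t) <= eucl_dist x y + `|s - t|.
Proof.
rewrite -(@ler_pXn2r _ 2)// ?nnegrE ?addr_ge0 ?eucl_dist_ge0//.
rewrite eucl_dist_lift3 [leRHS]sqrrD real_normK ?num_real// lerD// lerDl.
by rewrite mulrn_wge0// mulr_ge0// eucl_dist_ge0.
Qed.

Context (q : 'I_3 -> 'rV[R]_2) (S : set 'rV[R]_2) (f : 'rV[R]_2 -> R).
Context (hq : equidistant q) (hS : is_gasket q S).
Local Notation L := (word_map q).

Lemma graph_cover_ge : exists2 K : R, 0 < K & forall m d k,
  K * d < 2^-1 ^+ m -> has_cover (graph_on S f) d k -> (3 ^ m <= k)%N.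
Proof.
have [K K0 hK] := bary_lipschitz q; exists K => // m d k Kd [U [Ud SU]].
have /choice[g hg] : forall w : m.-tuple 'I_3, exists i : 'I_k,
    U i (lift3 (L w (q 0)) (f (L w (q 0)))).
  move=> w; have [|i _ Ui] := SU (lift3 (L w (q 0)) (f (L w (q 0)))).
    exists (L w (q 0)) => //; apply: (gasket_word_map _ _ hS).
    exact: gasket_corner hS _.
  by exists i.
suff /leq_card : injective g by rewrite card_tuple !card_ord.
move=> w w' gww'; apply/val_inj/eqP; apply: contraT => ww'.
have sww' : size w = size w' by rewrite !size_tuple.
(* Two graph points in one covering set would be at distance at most [d], so their coordinates would
   differ by at most K d < 2^-m, against separation. *)
have [s] := bary_word_map_sep q hq w w' (q 0) sww' ww'.
rewrite size_tuple leNgt (le_lt_trans _ Kd)// (le_trans (hK _ _ _))//.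
rewrite ler_pM2l//.
rewrite (le_trans (eucl_dist_lift3_ge _ _ (f (L w (q 0))) (f (L w' (q 0)))))//.
by apply: eucl_dist_le_diam (Ud (g w)) (hg w) _; rewrite gww'; exact: hg.
Qed.

(** Over a cell of level m the graph stays in a band of height 2 B r^m, cut here into [J] slabs of
    height 2^-m. *)
Lemma graph_cover_le (B r : R) :
  (forall w x, S x -> `|f (L w x) - f (L w (q 0))| <= B * r ^+ size w) ->
  exists2 D : R, 0 < D & forall m d (J : nat), D * 2^-1 ^+ m <= d ->
    2 * B * r ^+ m * 2 ^+ m < J%:R -> has_cover (graph_on S f) d (3 ^ m * J).
Proof.
move=> hf; have [D D0 hD] := gasket_diam q S hS.
(* [D] accounts for the width of the cell and 1 for the height of the slab, in units of 2^-m. *)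
exists (D + 1) => [|m d J Dd hJ]; first by rewrite addr_gt0.
pose base (w : seq 'I_3) := f (L w (q 0)) - B * r ^+ m.
pose U (i : m.-tuple 'I_3 * 'I_J) := [set p | exists x s,
  [/\ S x, i.2%:R * 2^-1 ^+ m <= s - base i.1 <= (i.2%:R + 1) * 2^-1 ^+ m
     & p = lift3 (L i.1 x) s]].
have -> : (3 ^ m * J = #|{: m.-tuple 'I_3 * 'I_J}|)%N.
  by rewrite card_prod card_tuple !card_ord.
apply: (has_cover_fin _ _ _ U) => [[w j]|p [y Sy <-]].
  apply: diam_le => p p' [x [s [Sx /andP[s1 s2] ->]]].
  move=> [y [t [Sy /andP[t1 t2] ->]]].
  rewrite (le_trans (eucl_dist_lift3_le _ _ _ _))// (le_trans _ Dd)//=.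
  rewrite mulrDl mul1r lerD//.
    rewrite eucl_dist_word_map size_tuple mulrC ler_wpM2r ?exprn_ge0//.
    exact: hD.
  by rewrite ler_norml; move: s1 s2 t1 t2 => /=; set a := _ ^+ _; clear; lra.
have [w [x Sx ->]] := gasket_decomp q S hS m y Sy.
have := hf w x Sx; rewrite size_tuple ler_norml => /andP[h1 h2].
set v := f (L w x) - base w.
have v0 : 0 <= v by rewrite /v /base; move: h1; clear; lra.
have v1 : v * 2 ^+ m < J%:R.
  rewrite (le_lt_trans _ hJ)// ler_wpM2r ?exprn_ge0//.
  by rewrite /v /base; move: h2; clear; lra.
have vm0 : 0 <= v * 2 ^+ m by rewrite mulr_ge0 ?exprn_ge0.
(* The integer part is the slab index; the strict bound on [J] keeps it in range. *)
have hj : (Num.trunc (v * 2 ^+ m) < J)%N by rewrite truncn_lt_nat.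
exists (w, Ordinal hj) => //; exists x, (f (L w x)); split=> //=.
rewrite -/v exprVn ler_pdivrMr ?ler_pdivlMr ?exprn_gt0//.
by have /andP[-> /ltW] := truncn_itv vm0; rewrite natr1.
Qed.

End Graph.

(** * From counts to dimensions *)

Theorem theorem5p6 (R : realType) (q : 'I_3 -> 'rV[R]_2) (S : set 'rV[R]_2)
    (f : 'rV[R]_2 -> R) (hq : equidistant q) (hS : is_gasket q S)
    (hf : dom_energy q S f) :
  [/\ ((ln 3 / ln 2)%:E <= lower_box_dim (graph_on S f))%E,
      (lower_box_dim (graph_on S f) <= upper_box_dim (graph_on S f))%E &
      (upper_box_dim (graph_on S f) <= (ln (108 / 5) / (2 * ln 2))%:E)%E].
Proof.
have ln20 : 0 < ln 2 :> R by rewrite ln_gt0// ltr1n.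
have ln30 : 0 < ln 3 :> R by rewrite ln_gt0// ltr1n.
have lnhalf m : ln (2^-1 ^+ m) = - (m%:R * ln 2) :> R.
  by rewrite lnXn ?invr_gt0// lnV ?posrE// mulNrn mulr_natl.
have ln_pow m (x : R) : 0 < x -> m%:R * ln x = ln (x ^+ m).
  by move=> x0; rewrite lnXn// mulr_natl.
have [M M0 edge] := dom_energy_edge q hq S f hf.
set r : R := Num.sqrt (3 / 5) in edge.
have r2 : r ^+ 2 = 3 / 5 by rewrite sqr_sqrtr.
have r0 : 0 < r by rewrite sqrtr_gt0.
have r1 : r < 1.
  by rewrite -(@ltr_pXn2r _ 2)// ?nnegrE ?(ltW r0)// r2 expr1n; lra.
have r2ge1 : 1 <= 2 * r.
  rewrite -(@ler_pXn2r _ 2)// ?nnegrE ?mulr_ge0 ?(ltW r0)//.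
  by rewrite exprMn r2 expr1n; lra.
have r01 : 0 <= r < 1 by rewrite (ltW r0).
set B := M / (1 - r).
have B0 : 0 <= B by rewrite divr_ge0// subr_ge0 ltW.
have osc w x := gasket_oscillation q S hS f M r hf.1 r01 M0 edge w x 0.
have [D D0 cover] := graph_cover_le q S f hS B r osc.
have [K K0 count] := graph_cover_ge q S f hq hS.
pose J m := (Num.trunc (2 * B * (2 * r) ^+ m)).+1.
have coverJ m d : D * 2^-1 ^+ m <= d ->
    has_cover (graph_on S f) d (3 ^ m * J m).
  move=> h; apply: cover => //; rewrite -mulrA -exprMn (mulrC r) /J.
  by rewrite truncnS_gt.
have near_scale (c : R) : 0 < c -> \forall d \near 0^'+, 0 < d /\ 0 < d * c < 1.
  move=> c0; near=> d.
  have d0 : 0 < d by near: d; exact: nbhs_right_gt.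
  split=> //; rewrite mulr_gt0//= -ltr_pdivlMr// mul1r.
  by near: d; apply: nbhs_right_lt; rewrite invr_gt0.
have near_cover c : 0 < c -> \forall d \near 0^'+, [/\ 0 < d, 0 < d * c < 1 &
    0 < d / D < 1].
  move=> c0; near=> d.
  have [d0 h1] : 0 < d /\ 0 < d * c < 1 by near: d; exact: near_scale.
  suff [_ h2] : 0 < d /\ 0 < d / D < 1 by split.
  by near: d; apply: near_scale; rewrite invr_gt0.
(* Level [n] is the coarsest whose slabs fit in diameter [d]; the step from [m] to [m.+1] costs the
   extra ln 2. *)
have scaleD d : 0 < d -> 0 < d / D < 1 -> exists2 n,
    has_cover (graph_on S f) d (3 ^ n * J n) &
    n%:R * ln 2 <= - ln d + (ln D + ln 2).
  move=> d0 hd; have [m /andP[m1 m2]] := dyadic_scale _ _ hd; exists m.+1.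
    by apply: coverJ; rewrite mulrC -ler_pdivlMr.
  have : ln (d / D) <= ln (2^-1 ^+ m).
    by rewrite ler_ln ?posrE ?divr_gt0 ?exprn_gt0 ?invr_gt0// ltW.
  by rewrite lnhalf ln_div ?posrE// -[m.+1%:R]natr1 mulrDl mul1r; clear; lra.
split; last 2 first.
- exact: lower_box_dim_le_upper.
- set b := ln (108 / 5) / _.
  have lnE : ln (108 / 5) = 2 * (ln 3 + ln (2 * r)) :> R.
    rewrite -lnM ?posrE ?mulr_gt0// [RHS]mulr_natl -lnXn ?mulr_gt0//.
    by congr ln; rewrite !exprMn r2; field.
  (* One more level multiplies the count by about 3 * 2 r, and [b] is the base 2 logarithm of this
     factor. *)
  have bE : b * ln 2 = ln 3 + ln (2 * r).
    by rewrite /b lnE; field; rewrite gt_eqF.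
  have b0 : 0 <= b.
    by rewrite divr_ge0 ?mulr_ge0 ?(ltW ln20)// ln_ge0//; lra.
  apply: (@upper_box_dim_le _ _ _ _ (ln (2 * B + 1) + b * (ln D + ln 2))).
  have := near_cover _ K0; apply: filterS.
  move=> d [d0 hK /(scaleD _ d0)[n hcov hn]].
  have [hcov' hN] := covering_numberP _ _ _ hcov.
  (* Comparing logarithms requires a nonzero count, which the lower count provides. *)
  have N0 : (0 < covering_number (graph_on S f) d)%N.
    have [m /andP[_ m2]] := dyadic_scale _ _ hK.
    rewrite (leq_trans _ (count m _ _ _ hcov')) ?expn_gt0//.
    by rewrite mulrC.
  have p0 : 0 < 2 * r by rewrite mulr_gt0.
  have B1 : 0 < 2 * B + 1 by rewrite ltr_wpDl// mulr_ge0.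
  (* Since 2 r >= 1, the successor in [J] adds at most (2 r)^n. *)
  have hJ : (J n)%:R <= (2 * B + 1) * (2 * r) ^+ n :> R.
    rewrite [leRHS]mulrDl mul1r /J -[leLHS]natr1 lerD//; last exact: exprn_ege1.
    by rewrite truncn_le (mulr_ge0 (mulr_ge0 _ B0))// exprn_ge0// ltW.
  have : ln (covering_number (graph_on S f) d)%:R <=
      n%:R * ln 3 + ln (2 * B + 1) + n%:R * ln (2 * r) :> R.
    rewrite !ln_pow// -!lnM ?posrE ?mulr_gt0 ?exprn_gt0//.
    rewrite ler_ln ?posrE ?mulr_gt0 ?exprn_gt0 ?ltr0n//.
    rewrite -mulrA (le_trans _ (ler_wpM2l _ hJ)) ?exprn_ge0//.
    by rewrite -natrX -natrM ler_nat.
  move=> /le_trans; apply.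
  have := ler_wpM2l b0 hn; rewrite mulrCA bE mulrDr.
  by clear; lra.
- set a := ln 3 / ln 2.
  (* The term ln 3 pays for the level lost between [m] and [m.+1], and a ln K for the Lipschitz
     constant. *)
  apply: (@lower_box_dim_ge _ _ _ _ (ln 3 + a * ln K)).
  (* Here [scaleD] only supplies some finite cover, so that the covering number is attained. *)
  have := near_cover _ K0; apply: filterS => d [d0 hK /(scaleD _ d0)[n hcov _]].
  have [m /andP[m1 m2]] := dyadic_scale _ _ hK.
  have [/(count m)] := covering_numberP _ _ _ hcov.
  rewrite mulrC => /(_ m2) hN _.
  have : m%:R * ln 3 <= ln (covering_number (graph_on S f) d)%:R :> R.
    rewrite ln_pow// ler_ln ?posrE ?exprn_gt0//.
      by rewrite -natrX ler_nat.
    by rewrite ltr0n (leq_trans _ hN)// expn_gt0.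
  apply: le_trans.
  have : ln (2^-1 ^+ m.+1) <= ln (d * K).
    by rewrite ler_ln ?posrE ?mulr_gt0 ?exprn_gt0 ?invr_gt0.
  have a0 : 0 <= a by rewrite divr_ge0// ltW.
  rewrite lnhalf lnM ?posrE// => /(ler_wpM2l a0).
  rewrite mulrN mulrCA /a mulfVK ?gt_eqF// -/a -[m.+1%:R]natr1.
  by clear; lra.
Unshelve. all: by end_near. Qed.
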